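(* Let $(M^7,g,\phi)$ be a 7-dimensional Riemannian spin manifold with unit spinor field $\phi$. Then $\phi$ is harmonic, $D\phi=0$, if and only if the underlying $\mathrm{G}_2$-structure is of class $\mathcal{W}_{23}$.
   Context: Conventions. $(M^7,g)$ is an oriented Riemannian spin manifold; $\Sigma$ is its real rank-8 spinor bundle (Clifford algebra with $X^2=-|X|^2$; $e_1\cdots e_7=-\mathrm{Id}$ for positively oriented orthonormal frames), with inner product $(\cdot,\cdot)$ for which vectors act skew-symmetrically. $\nabla$ is the Levi-Civita connection and its lift; $D=\sum_ie_i\nabla_{e_i}$ is the Riemannian Dirac operator. The unit spinor $\phi$ induces a $\mathrm{G}_2$-structure with 3-form $\Psi_\phi(X,Y,Z)=(XYZ\phi,\phi)=g(X\times Y,Z)$, and its intrinsic endomorphism $S$ is the unique endomorphism field of $TM$ with $\nabla_X\phi=S(X)\phi$. Classes: pointwise $\mathrm{End}(TM)=\mathcal{W}_1\oplus\mathcal{W}_2\oplus\mathcal{W}_3\oplus\mathcal{W}_4$ with $\mathcal{W}_1=\mathbb{R}\,\mathrm{Id}$, $\mathcal{W}_2=\mathfrak{g}_2$ (derivations of the cross product $\times$), $\mathcal{W}_3$ = symmetric traceless endomorphisms, $\mathcal{W}_4=\{X\mapsto V\times X\}$. Class $\mathcal{W}_{23}$ means $S\in\mathcal{W}_2\oplus\mathcal{W}_3$ at every point. *)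

(* Defs.v *)
From HB Require Import structures.
From mathcomp Require Import all_boot all_order all_algebra.
From mathcomp Require Import all_classical all_reals all_analysis.

Set Implicit Arguments.
Unset Strict Implicit.
Unset Printing Implicit Defensive.

Import Order.TTheory GRing.Theory Num.Theory numFieldNormedType.Exports.
Local Open Scope classical_set_scope.
Local Open Scope ring_scope.

(* Smooth maps on an open set U of R^7; the values of f outside U play no     *)
(* role, because U is open wherever these are used.                           *)
Fixpoint Cn (R : realType) (V : normedModType R) (n : nat)
    (U : set 'rV[R]_7) (f : 'rV[R]_7 -> V) : Prop :=
  (forall x, U x -> {for x, continuous f}) /\
  if n is n'.+1 then
    forall v, (forall x, U x -> derivable f x v) /\ Cn n' U ('D_v f)
  else True.

Definition Cinfty (R : realType) (V : normedModType R)
    (U : set 'rV[R]_7) (f : 'rV[R]_7 -> V) : Prop :=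
  forall n, Cn n U f.

(* An oriented smooth structure of dimension 7, given by an oriented atlas.   *)
(* The chart cmap a is only meaningful on cdom a, and cinv a on its image.    *)
(* A chart chart_at p around every point p is part of the data.               *)
Record oriented_atlas (R : realType) (M : topologicalType) := OrientedAtlas {
  M_hausdorff : hausdorff_space M;
  M_second_countable : @second_countable M;
  chart : Type;
  cdom : chart -> set M;
  cmap : chart -> M -> 'rV[R]_7;
  cinv : chart -> 'rV[R]_7 -> M;
  cdom_open : forall a, open (cdom a);
  cimg_open : forall a, open (cmap a @` cdom a);
  cmapK : forall a p, cdom a p -> cinv a (cmap a p) = p;
  cmap_continuous : forall a p, cdom a p -> {for p, continuous (cmap a)};
  cinv_continuous : forall a x,
    (cmap a @` cdom a) x -> {for x, continuous (cinv a)};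
  transition_smooth : forall a b,
    Cinfty (cmap a @` (cdom a `&` cdom b)) (cmap b \o cinv a);
  transition_oriented : forall a b x, (cmap a @` (cdom a `&` cdom b)) x ->
    0 < \det ('J (cmap b \o cinv a) x);
  chart_at : M -> chart;
  mem_chart_at : forall p, cdom (chart_at p) p
}.

Section OrientedManifold.
Variables (R : realType) (M : topologicalType) (A : oriented_atlas R M).

Definition smooth_on (V : normedModType R) (U : set M) (f : M -> V) : Prop :=
  forall a : chart A, Cinfty (cmap a @` (U `&` cdom a)) (f \o cinv a).

(* The tangent space T_pM is R^7, a vector being identified with its          *)
(* coordinates in the chart chart_at A p. Accordingly a vector field is a map *)
(* X : M -> 'rV_7, whose values at different points may refer to different    *)
(* charts. With this convention, tdiff f p v is df_p(v).                       *)
Definition tdiff (V : normedModType R) (f : M -> V) (p : M) (v : 'rV[R]_7) : V :=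
  'D_v (f \o cinv (chart_at A p)) (cmap (chart_at A p) p).

(* tdiff (cmap a) q (X q) is the coordinate vector of X(q) in the chart a.     *)
Definition smooth_field_on (U : set M) (X : M -> 'rV[R]_7) : Prop :=
  forall a : chart A,
    smooth_on (U `&` cdom a) (fun q => tdiff (cmap a) q (X q)).

Definition smooth_near (V : normedModType R) (p : M) (f : M -> V) : Prop :=
  exists2 U, open_nbhs p U & smooth_on U f.

Definition smooth_field_near (p : M) (X : M -> 'rV[R]_7) : Prop :=
  exists2 U, open_nbhs p U & smooth_field_on U X.

(* [X, Y] = dY(X) - dX(Y) for the components of X and Y in the chart at p.    *)
Definition lie_bracket (X Y : M -> 'rV[R]_7) (p : M) : 'rV[R]_7 :=
  tdiff (fun q => tdiff (cmap (chart_at A p)) q (Y q)) p (X p) -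
  tdiff (fun q => tdiff (cmap (chart_at A p)) q (X q)) p (Y p).

Record riemannian_metric := RiemannianMetric {
  metric :> M -> 'rV[R]_7 -> 'rV[R]_7 -> R;
  metricC : forall p u v, metric p u v = metric p v u;
  metric_linear : forall p c u v w,
    metric p (c *: u + v) w = c * metric p u w + metric p v w;
  metric_gt0 : forall p u, u != 0 -> 0 < metric p u u;
  metric_smooth : forall (U : set M) (X Y : M -> 'rV[R]_7), open U ->
    smooth_field_on U X -> smooth_field_on U Y ->
    smooth_on U (fun q => metric q (X q) (Y q) : R^o)
}.

(* nabla p v Y is the covariant derivative of Y at p in the direction v.      *)
Record affine_connection (nabla : M -> 'rV[R]_7 -> (M -> 'rV[R]_7) -> 'rV[R]_7)
    : Prop := AffineConnection {
  nabla_linear : forall p c u v Y, smooth_field_near p Y ->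
    nabla p (c *: u + v) Y = c *: nabla p u Y + nabla p v Y;
  nablaD : forall p v Y Z, smooth_field_near p Y -> smooth_field_near p Z ->
    nabla p v (fun q => Y q + Z q) = nabla p v Y + nabla p v Z;
  nabla_leibniz : forall p v (f : M -> R^o) Y,
    smooth_near p f -> smooth_field_near p Y ->
    nabla p v (fun q => f q *: Y q) = tdiff f p v *: Y p + f p *: nabla p v Y;
  nabla_smooth : forall (U : set M) X Y, open U ->
    smooth_field_on U X -> smooth_field_on U Y ->
    smooth_field_on U (fun q => nabla q (X q) Y)
}.

Record levi_civita (g : riemannian_metric)
    (nabla : M -> 'rV[R]_7 -> (M -> 'rV[R]_7) -> 'rV[R]_7) : Prop :=
    LeviCivita {
  lc_connection : affine_connection nabla;
  lc_torsion_free : forall p X Y,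
    smooth_field_near p X -> smooth_field_near p Y ->
    nabla p (X p) Y - nabla p (Y p) X = lie_bracket X Y p;
  lc_metric : forall p v Y Z,
    smooth_field_near p Y -> smooth_field_near p Z ->
    tdiff (fun q => g q (Y q) (Z q) : R^o) p v =
      g p (nabla p v Y) (Z p) + g p (Y p) (nabla p v Z)
}.

End OrientedManifold.

(* A real 8-dimensional Clifford module over R^7, given by the action of the  *)
(* standard basis.                                                            *)
Record clifford_module (R : realType) (gamma : 'I_7 -> 'M[R]_8) : Prop :=
    CliffordModule {
  gamma_skew : forall i, (gamma i)^T = - gamma i;
  gamma_clifford : forall i j,
    gamma i *m gamma j + gamma j *m gamma i = (- 2 * (i == j)%:R)%:M;
  gamma_volume : \prod_(i < 7) gamma i = - 1
}.

Definition gammav (R : realType) (gamma : 'I_7 -> 'M[R]_8) (v : 'rV[R]_7)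
    : 'M[R]_8 :=
  \sum_i v 0 i *: gamma i.

(* The group Spin(7), embedded in GL_8(R) by its (faithful) real spin         *)
(* representation.                                                            *)
Definition spin_group (R : realType) (gamma : 'I_7 -> 'M[R]_8) : set 'M[R]_8 :=
  [set s | exists vs : seq 'rV[R]_7,
    [/\ ~~ odd (size vs),
        forall v, v \in vs -> v *m v^T = 1%:M
      & s = \prod_(v <- vs) gammav gamma v]].

(* A spin structure, by local data: positively oriented orthonormal frames    *)
(* over an open cover, with a Spin(7)-valued cocycle lifting the transition   *)
(* functions of the frames (spin_lift says that the double cover              *)
(* Spin(7) -> SO(7) maps spin_trans a b p to the matrix expressing the frame  *)
(* b in the frame a). spin_at p selects a member of the cover containing p.   *)
Record spin_structure (R : realType) (M : topologicalType)
    (A : oriented_atlas R M) (g : riemannian_metric A)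
    (gamma : 'I_7 -> 'M[R]_8) := SpinStructure {
  spin_ix : Type;
  spin_dom : spin_ix -> set M;
  spin_dom_open : forall a, open (spin_dom a);
  spin_at : M -> spin_ix;
  mem_spin_at : forall p, spin_dom (spin_at p) p;
  spin_frame : spin_ix -> 'I_7 -> M -> 'rV[R]_7;
  spin_frame_smooth : forall a i,
    smooth_field_on A (spin_dom a) (spin_frame a i);
  spin_frame_orthonormal : forall a i j p, spin_dom a p ->
    g p (spin_frame a i p) (spin_frame a j p) = (i == j)%:R;
  spin_frame_oriented : forall a p, spin_dom a p ->
    0 < \det (\matrix_i spin_frame a i p);
  spin_trans : spin_ix -> spin_ix -> M -> 'M[R]_8;
  spin_trans_smooth : forall a b,
    smooth_on A (spin_dom a `&` spin_dom b) (spin_trans a b);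
  spin_trans_spin : forall a b p, spin_dom a p -> spin_dom b p ->
    spin_group gamma (spin_trans a b p);
  spin_lift : forall a b p j, spin_dom a p -> spin_dom b p ->
    spin_trans a b p *m gamma j =
      (\sum_i g p (spin_frame a i p) (spin_frame b j p) *: gamma i)
        *m spin_trans a b p;
  spin_cocycle : forall a b c p,
    spin_dom a p -> spin_dom b p -> spin_dom c p ->
    spin_trans a b p *m spin_trans b c p = spin_trans a c p
}.

Section SpinGeometry.
Variables (R : realType) (M : topologicalType) (A : oriented_atlas R M).
Variables (g : riemannian_metric A) (gamma : 'I_7 -> 'M[R]_8).
Variable P : spin_structure g gamma.
Variable nabla : M -> 'rV[R]_7 -> (M -> 'rV[R]_7) -> 'rV[R]_7.

(* The fibre of the spinor bundle at p is R^8, through the trivialization     *)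
(* over spin_dom (spin_at P p); a spinor field is thus a map M -> 'cV_8, and  *)
(* spinor_in a phi is its expression in the trivialization a. The spin        *)
(* representation is orthogonal, so that the inner product does not depend    *)
(* on the trivialization.                                                     *)
Definition spinor_in (a : spin_ix P) (phi : M -> 'cV[R]_8) (q : M) : 'cV[R]_8 :=
  spin_trans a (spin_at P q) q *m phi q.

Definition smooth_spinor (phi : M -> 'cV[R]_8) : Prop :=
  forall a : spin_ix P, smooth_on A (spin_dom a) (spinor_in a phi).

Definition spdot (phi psi : 'cV[R]_8) : R := (phi^T *m psi) 0 0.

Definition unit_spinor (phi : M -> 'cV[R]_8) : Prop :=
  forall p, spdot (phi p) (phi p) = 1.

Definition frame_at (p : M) (i : 'I_7) : 'rV[R]_7 :=
  spin_frame (spin_at P p) i p.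

Definition clifford (p : M) (X : 'rV[R]_7) (psi : 'cV[R]_8) : 'cV[R]_8 :=
  (\sum_i g p X (frame_at p i) *: gamma i) *m psi.

(* The lift of nabla to spinors: in the trivialization given by the local     *)
(* frame (e_i), d + 1/4 \sum_(i, j) g(nabla e_i, e_j) e_i e_j.                *)
Definition spin_nabla (p : M) (X : 'rV[R]_7) (phi : M -> 'cV[R]_8) : 'cV[R]_8 :=
  let e := spin_frame (spin_at P p) in
  tdiff A (spinor_in (spin_at P p) phi) p X +
  4^-1 *: \sum_i \sum_j
    g p (nabla p X (e i)) (e j p) *: (gamma i *m gamma j *m phi p).

Definition dirac_op (phi : M -> 'cV[R]_8) (p : M) : 'cV[R]_8 :=
  \sum_i clifford p (frame_at p i) (spin_nabla p (frame_at p i) phi).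

Definition harmonic_spinor (phi : M -> 'cV[R]_8) : Prop := forall p, dirac_op phi p = 0.

Section G2.
Variable phi : M -> 'cV[R]_8.

Definition Psi (p : M) (X Y Z : 'rV[R]_7) : R :=
  spdot (clifford p X (clifford p Y (clifford p Z (phi p)))) (phi p).

(* The vector X x Y with g(X x Y, Z) = Psi(X, Y, Z); see metric_cross.        *)
Definition cross (p : M) (X Y : 'rV[R]_7) : 'rV[R]_7 :=
  \sum_i Psi p X Y (frame_at p i) *: frame_at p i.

(* Endomorphisms of T_pM are matrices acting on row vectors from the right.   *)
Definition intrinsic_endomorphism (S : M -> 'M[R]_7) : Prop :=
  forall p X, spin_nabla p X phi = clifford p (X *m S p) (phi p).

Definition W2 (p : M) (B : 'M[R]_7) : Prop :=
  forall X Y, cross p X Y *m B = cross p (X *m B) Y + cross p X (Y *m B).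

Definition W3 (p : M) (B : 'M[R]_7) : Prop :=
  (forall X Y, g p (X *m B) Y = g p X (Y *m B)) /\ \tr B = 0.

Definition W23 (p : M) (B : 'M[R]_7) : Prop :=
  exists B2 B3, [/\ W2 p B2, W3 p B3 & B = B2 + B3].

Definition class_W23 : Prop :=
  exists2 S, intrinsic_endomorphism S & forall p, W23 p (S p).

Lemma metric_cross p X Y Z : g p (cross p X Y) Z = Psi p X Y Z.
Proof.
pose F : 'M[R]_7 := \matrix_i frame_at p i.
have F_unit : F \in unitmx.
  rewrite unitmxE unitfE gt_eqF//.
  exact: spin_frame_oriented (mem_spin_at P p).
have gD u v w : g p (u + v) w = g p u w + g p v w.
  by rewrite -[u]scale1r metric_linear mul1r scale1r.
have g0 w : g p 0 w = 0.
  by apply: (@addrI _ (g p 0 w)); rewrite -gD !addr0.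
have gZ c u w : g p (c *: u) w = c * g p u w.
  by rewrite -[c *: u]addr0 metric_linear g0 addr0.
have g_sum I (r : seq I) (G : I -> 'rV[R]_7) w :
    g p (\sum_(i <- r) G i) w = \sum_(i <- r) g p (G i) w.
  exact: (big_morph (fun u => g p u w) (fun u v => gD u v w) (g0 w)).
pose c i := (Z *m invmx F) 0 i.
have ZE : Z = \sum_i c i *: frame_at p i.
  rewrite -[LHS](mulmxKV F_unit) mulmx_sum_row.
  by apply: eq_bigr => i _; rewrite rowK.
have gZe i : g p Z (frame_at p i) = c i.
  rewrite ZE g_sum (bigD1 i)//= gZ.
  rewrite (spin_frame_orthonormal _ _ (mem_spin_at P p)) eqxx mulr1.
  rewrite big1 ?addr0// => j ji.
  rewrite gZ (spin_frame_orthonormal _ _ (mem_spin_at P p)) (negPf ji).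
  by rewrite mulr0.
have cliffZ : clifford p Z (phi p) =
    \sum_i c i *: clifford p (frame_at p i) (phi p).
  rewrite /clifford mulmx_suml; apply: eq_bigr => i _.
  rewrite gZe -scalemxAl; congr (_ *: (_ *m _)).
  rewrite (bigD1 i)//= (spin_frame_orthonormal _ _ (mem_spin_at P p)) eqxx.
  rewrite scale1r big1 ?addr0// => j ji.
  rewrite (spin_frame_orthonormal _ _ (mem_spin_at P p)) eq_sym (negPf ji).
  by rewrite scale0r.
rewrite /cross g_sum /Psi cliffZ.
rewrite /clifford !mulmx_sumr /spdot linear_sum/= mulmx_suml summxE.
apply: eq_bigr => i _.
rewrite gZ metricC gZe -!scalemxAr linearZ/= -scalemxAl [RHS]mxE.
exact: mulrC.
Qed.

End G2.
End SpinGeometry.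

(* Main.v *)
From HB Require Import structures.
Require Import Defs.
From mathcomp Require Import all_boot all_order all_algebra.
From mathcomp Require Import all_classical all_reals all_analysis.
From mathcomp Require Import ring lra.

(* In an orthonormal frame at p, let s be the matrix of S. As phi and the     *)
(* e_i phi form an orthonormal basis of the spinors, D phi = 0 means that     *)
(* tr s = 0 and tr (s L_v) = 0 for all v, where L_v w = v * w is the cross    *)
(* product. The symmetric part of s always satisfies the second condition,    *)
(* and it remains to see that a skew b satisfies it iff it is a derivation of *)
(* the cross product.                                                         *)
(* If b is a derivation then [b, L_x] = L_(b x). As tr (L_x L_y) = -6 <x, y>, *)
(* b is skew, and pairing b with the identity                                 *)
(* [L_x, L_y] = -2 L_(x * y) + 3 (y x^T - x y^T) gives tr (b L_(x * y)) = 0;  *)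
(* the products x * y span R^7.                                               *)
(* Conversely, a multiple B of \sum b_ij e_i e_j satisfies [B, x] = b x for   *)
(* Clifford multiplication by x and kills phi; applying it to                 *)
(* x y phi = - <x, y> phi - (x * y) phi shows that b is a derivation.         *)
(* S exists because nabla phi is tensorial and orthogonal to phi.             *)

Set Implicit Arguments.
Unset Strict Implicit.
Unset Printing Implicit Defensive.

Import Order.TTheory GRing.Theory Num.Theory numFieldNormedType.Exports.
Local Open Scope classical_set_scope.
Local Open Scope ring_scope.

(** Everything reduces to linear algebra at a point once the frame matrix [s] of S is available.
    [spinor_dec] writes a spinor as a multiple of phi plus a vector times phi; as nabla phi is
    linear in the direction ([spin_nabla_linear]) and orthogonal to phi ([spdot_spin_nabla]), this
    yields [s] ([spin_nabla_frame]). Then D phi is the sum of s_ij e_i e_j phi ([dirac_opE]), and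
    [quad_sum_phi] gives its components: - tr s along phi, and the vector with entries tr (s L_k).
    The first is the W1 part of s up to a factor; the second sees only the skew part and measures
    W4. That its vanishing leaves exactly g2 is [derivation_mxtrace] one way and [skew_derivation]
    the other, combined in [trace_conditionP]. [W23P] carries the classes between the tangent space
    and frame coordinates. *)

Section SpinorAlgebra.
Variables (R : realType) (gamma : 'I_7 -> 'M[R]_8).
Hypothesis gamma_cl : clifford_module gamma.

(** * Dot products and Clifford multiplication *)

Definition dotr (x y : 'rV[R]_7) : R := (x *m y^T) 0 0.

Lemma dotrE x y : dotr x y = \sum_i x 0 i * y 0 i.
Proof. by rewrite /dotr mxE; apply: eq_bigr => i _; rewrite mxE. Qed.

Lemma dotrM x y : x *m y^T = (dotr x y)%:M.
Proof. by rewrite [LHS]mx11_scalar. Qed.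

Lemma dotrC x y : dotr x y = dotr y x.
Proof. by rewrite !dotrE; apply: eq_bigr => i _; rewrite mulrC. Qed.

Lemma dotrZl c x z : dotr (c *: x) z = c * dotr x z.
Proof. by rewrite /dotr -scalemxAl mxE. Qed.

Lemma dotrNl x z : dotr (- x) z = - dotr x z.
Proof. by rewrite -scaleN1r dotrZl mulN1r. Qed.

Lemma dotr_mulmx b x y : dotr (x *m b) y = dotr x (y *m b^T).
Proof. by rewrite /dotr trmx_mul trmxK mulmxA. Qed.

Lemma dotr_deltar x i : dotr x (delta_mx 0 i) = x 0 i.
Proof. by rewrite /dotr trmx_delta -colE mxE. Qed.

Lemma dotr_delta i j : dotr (delta_mx 0 i) (delta_mx 0 j) = (i == j)%:R.
Proof. by rewrite dotr_deltar mxE eqxx eq_sym. Qed.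

Lemma dotr_deltaM i j (b : 'M[R]_7) :
  dotr (delta_mx 0 i *m b) (delta_mx 0 j) = b i j.
Proof. by rewrite dotr_deltar -rowE mxE. Qed.

Lemma dotr_inj x y : (forall z, dotr x z = dotr y z) -> x = y.
Proof.
move=> xy; apply/rowP => i; have := xy (delta_mx 0 i).
by rewrite !dotr_deltar.
Qed.

Lemma mxtrace_dotr x y : \tr (y^T *m x) = dotr x y.
Proof. by rewrite mxtrace_mulC /mxtrace big_ord1. Qed.

Lemma gammav_is_linear : linear (gammav gamma).
Proof.
move=> c u v; rewrite /gammav scaler_sumr -big_split/=.
by apply: eq_bigr => i _; rewrite !mxE scalerDl scalerA.
Qed.
HB.instance Definition _ := GRing.isLinear.Build R 'rV[R]_7 'M[R]_8 _
  (gammav gamma) gammav_is_linear.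

Lemma gammav_delta i : gammav gamma (delta_mx 0 i) = gamma i.
Proof.
rewrite /gammav (bigD1 i)//= mxE !eqxx scale1r big1 ?addr0// => j ji.
by rewrite mxE (negPf ji) scale0r.
Qed.

Lemma gammav_mulE x (a : 'cV[R]_8) :
  gammav gamma x *m a = \sum_i x 0 i *: (gamma i *m a).
Proof.
by rewrite /gammav mulmx_suml; apply: eq_bigr => i _; rewrite scalemxAl.
Qed.

Lemma gammav_clifford x y : gammav gamma x *m gammav gamma y +
  gammav gamma y *m gammav gamma x = (- 2 * dotr x y)%:M.
Proof.
have E u v : gammav gamma u *m gammav gamma v =
    \sum_i \sum_j (u 0 i * v 0 j) *: (gamma i *m gamma j).
  rewrite /gammav mulmx_suml; apply: eq_bigr => i _.
  rewrite mulmx_sumr; apply: eq_bigr => j _.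
  by rewrite -scalemxAl -scalemxAr scalerA.
rewrite !E [X in _ + X]exchange_big -big_split/= dotrE mulr_sumr raddf_sum/=.
apply: eq_bigr => i _; rewrite -big_split/= (bigD1 i)//= big1 => [|j ji].
  rewrite addr0 [y 0 i * _]mulrC -scalerDr (gamma_clifford gamma_cl) eqxx.
  by rewrite mulr1 scale_scalar_mx mulrC.
rewrite [y 0 j * _]mulrC -scalerDr (gamma_clifford gamma_cl) eq_sym.
by rewrite (negPf ji) mulr0 scale_scalar_mx mulr0 raddf0.
Qed.

Lemma gammav_tr x : (gammav gamma x)^T = - gammav gamma x.
Proof.
rewrite /gammav raddf_sum/= -sumrN; apply: eq_bigr => i _.
by rewrite linearZ/= (gamma_skew gamma_cl) scalerN.
Qed.

Lemma spdotC (a b : 'cV[R]_8) : spdot a b = spdot b a.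
Proof. by rewrite /spdot -[in RHS](trmxK a) -trmx_mul [RHS]mxE. Qed.

Lemma spdotDl (a b c : 'cV[R]_8) : spdot (a + b) c = spdot a c + spdot b c.
Proof. by rewrite /spdot raddfD/= mulmxDl mxE. Qed.

Lemma spdotZl k (a c : 'cV[R]_8) : spdot (k *: a) c = k * spdot a c.
Proof. by rewrite /spdot linearZ/= -scalemxAl mxE. Qed.

Lemma spdot_suml I (r : seq I) (F : I -> 'cV[R]_8) c :
  spdot (\sum_(i <- r) F i) c = \sum_(i <- r) spdot (F i) c.
Proof. by rewrite /spdot raddf_sum/= mulmx_suml summxE. Qed.

Lemma mulmx_col_spdot m n (A : 'M[R]_(8, m)) (B : 'M[R]_(8, n)) i j :
  (A^T *m B) i j = spdot (col i A) (col j B).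
Proof. by rewrite /spdot !mxE; apply: eq_bigr => k _; rewrite !mxE. Qed.

Lemma col_cV (a : 'cV[R]_8) : col 0 a = a.
Proof. by apply/colP => i; rewrite mxE. Qed.

Lemma spdot_gammav x a b :
  spdot (gammav gamma x *m a) b = - spdot a (gammav gamma x *m b).
Proof. by rewrite /spdot trmx_mul gammav_tr mulmxN mulNmx mxE mulmxA. Qed.

(** * Spinors as multiples of phi plus vectors times phi, and the resulting cross product *)

Variable phi : 'cV[R]_8.
Hypothesis phi1 : spdot phi phi = 1.

Lemma spdot_skew (A : 'M[R]_8) : A^T = - A -> spdot (A *m phi) phi = 0.
Proof.
move=> At; have : spdot (A *m phi) phi = - spdot (A *m phi) phi.
  by rewrite {2}spdotC /spdot trmx_mul At mulmxN mulNmx mxE mulmxA.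
by move=> /eqP; rewrite -subr_eq0 opprK -mulr2n mulrn_eq0 => /eqP.
Qed.

Lemma spdot_gammav_phi x : spdot (gammav gamma x *m phi) phi = 0.
Proof. exact/spdot_skew/gammav_tr. Qed.

(** Skewness of vectors turns the left side into -(y x phi, phi); it is symmetric in x and y, and
    the symmetrised product is a scalar by the Clifford relation. *)
Lemma spdot_gammav2_phi x y :
  spdot (gammav gamma x *m phi) (gammav gamma y *m phi) = dotr x y.
Proof.
have H u v : spdot (gammav gamma u *m phi) (gammav gamma v *m phi) =
  - spdot (gammav gamma v *m gammav gamma u *m phi) phi.
  by rewrite -mulmxA [in RHS]spdot_gammav opprK.
have : spdot ((gammav gamma x *m gammav gamma y +
  gammav gamma y *m gammav gamma x) *m phi) phi = - 2 * dotr x y.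
  by rewrite gammav_clifford mul_scalar_mx spdotZl phi1 mulr1.
rewrite mulmxDl spdotDl => E.
have := H y x; rewrite spdotC => /eqP; rewrite -eqr_oppLR => /eqP E1.
have := H x y => /eqP; rewrite -eqr_oppLR => /eqP E2.
move: E; rewrite -E1 -E2; lra.
Qed.

Definition spinor_vec (psi : 'cV[R]_8) : 'rV[R]_7 :=
  \row_k spdot psi (gamma k *m phi).

Lemma spinor_dec psi :
  psi = spdot psi phi *: phi + gammav gamma (spinor_vec psi) *m phi.
Proof.
(* Q^T Q = 1 implies Q Q^T = 1, because Q is square. *)
pose Q : 'M[R]_(8, 1 + 7) := row_mx phi (\matrix_(i, j) (gamma j *m phi) i 0).
have colQ j : col j (\matrix_(i, j) (gamma j *m phi) i 0) = gamma j *m phi.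
  by apply/colP => i; rewrite !mxE.
have QQ : Q^T *m Q = (1%:M : 'M[R]_(1 + 7)).
  rewrite /Q tr_row_mx mul_col_row.
  apply: (etrans _ (esym (@scalar_mx_block R 1 7 1))).
  congr block_mx.
  - by rewrite [LHS]mx11_scalar; congr (_%:M); rewrite -phi1.
  - apply/rowP => j; rewrite mulmx_col_spdot colQ col_cV [RHS]mxE.
    by rewrite -gammav_delta spdotC spdot_gammav_phi.
  - apply/colP => j; rewrite mulmx_col_spdot colQ col_cV [RHS]mxE.
    by rewrite -gammav_delta spdot_gammav_phi.
  - apply/matrixP => i j; rewrite mulmx_col_spdot !colQ -!gammav_delta.
    by rewrite spdot_gammav2_phi dotr_delta mxE.
have := mulmx1C (QQ : Q^T *m Q = (1%:M : 'M[R]_8)).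
rewrite /Q tr_row_mx mul_row_col => QQ'.
rewrite -[LHS]mul1mx -QQ' mulmxDl -!mulmxA; congr (_ + _).
  rewrite [phi^T *m psi]mx11_scalar mul_mx_scalar.
  by rewrite -[_ 0 0]/(spdot phi psi) spdotC.
rewrite gammav_mulE; apply/colP => i; rewrite mxE summxE.
apply: eq_bigr => k _; rewrite mulmx_col_spdot colQ col_cV spdotC.
by rewrite [RHS]mxE mxE [spinor_vec _ _ _]mxE mulrC.
Qed.

Lemma spinor_vec_gammav c x : spinor_vec (c *: phi + gammav gamma x *m phi) = x.
Proof.
apply: dotr_inj => z; rewrite dotrE [RHS]dotrE; apply: eq_bigr => k _.
congr (_ * _); rewrite mxE spdotDl spdotZl -gammav_delta.
by rewrite spdot_gammav2_phi spdotC spdot_gammav_phi mulr0 add0r dotr_deltar.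
Qed.

Lemma gammav_phi_inj c d x y :
  c *: phi + gammav gamma x *m phi = d *: phi + gammav gamma y *m phi ->
  c = d /\ x = y.
Proof.
move=> E; have E2 := congr1 spinor_vec E; rewrite !spinor_vec_gammav in E2.
split=> //; have := congr1 (fun a => spdot a phi) E.
by rewrite !spdotDl !spdotZl !spdot_gammav_phi phi1 !addr0 !mulr1.
Qed.

Lemma gammav_phi_inj1 x y :
  gammav gamma x *m phi = gammav gamma y *m phi -> x = y.
Proof.
by move=> E; case: (@gammav_phi_inj 0 0 x y) => //; rewrite !scale0r !add0r.
Qed.

(* y *m crossmx x is the cross product x * y; as matrices act from the right, *)
(* crossmx y *m crossmx x is v |-> x * (y * v).                               *)
Definition crossmx (x : 'rV[R]_7) : 'M[R]_7 :=
  \matrix_(i, k) spdot (gamma k *m (gammav gamma x *m (gamma i *m phi))) phi.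

Lemma crossmx_spdot x y z : dotr (y *m crossmx x) z =
  spdot (gammav gamma z *m (gammav gamma x *m (gammav gamma y *m phi))) phi.
Proof.
rewrite dotrE (gammav_mulE z) spdot_suml; apply: eq_bigr => k _.
rewrite spdotZl mulrC; congr (_ * _).
rewrite mxE (gammav_mulE y) !mulmx_sumr spdot_suml; apply: eq_bigr => i _.
by rewrite mxE -!scalemxAr spdotZl.
Qed.

(** The dictionary between Clifford and cross products: identities for the latter are obtained by
    acting on phi and comparing components. The minus sign before the cross product comes from the
    skewness of vectors. *)
Lemma gammav_mul_phi x y : gammav gamma x *m (gammav gamma y *m phi) =
  - dotr x y *: phi - gammav gamma (y *m crossmx x) *m phi.
Proof.
rewrite [LHS]spinor_dec; congr (_ + _).
  by rewrite spdot_gammav spdot_gammav2_phi dotrC.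
rewrite -mulNmx -raddfN; congr (gammav gamma _ *m _).
apply: dotr_inj => z; rewrite -scaleN1r dotrZl mulN1r crossmx_spdot.
rewrite spdot_gammav opprK (gammav_mulE z) spdotC spdot_suml dotrE.
by apply: eq_bigr => i _; rewrite spdotZl mxE mulrC spdotC.
Qed.

Lemma crossmx_is_linear : linear crossmx.
Proof.
move=> c u v; apply/matrixP => i k.
by rewrite !mxE linearP/= mulmxDl mulmxDr -scalemxAl -scalemxAr spdotDl spdotZl.
Qed.
HB.instance Definition _ := GRing.isLinear.Build R 'rV[R]_7 'M[R]_7 _
  crossmx crossmx_is_linear.

Lemma cross_skew x y : y *m crossmx x = - (x *m crossmx y).
Proof.
apply: gammav_phi_inj1.
have := congr1 (mulmx^~ phi) (gammav_clifford x y).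
rewrite mulmxDl -!mulmxA !gammav_mul_phi mul_scalar_mx (dotrC y x).
rewrite addrACA -scalerDl.
rewrite (_ : - dotr x y - dotr x y = - 2 * dotr x y); last ring.
move=> /eqP; rewrite -subr_eq0 addrAC subrr add0r -opprD oppr_eq0 addr_eq0.
by rewrite raddfN mulNmx => /eqP.
Qed.

(** Apply the Clifford relation for x, y to the spinor v phi and compare vector components. *)
Lemma crossmx_anticomm x y : crossmx y *m crossmx x + crossmx x *m crossmx y =
  (- 2 * dotr x y)%:M + y^T *m x + x^T *m y.
Proof.
apply/row_matrixP => i; rewrite !rowE; move: (delta_mx 0 i) => v.
rewrite !mulmxDr !mulmxA mul_mx_scalar !dotrM !mul_scalar_mx.
have H u w : gammav gamma u *m (gammav gamma w *m (gammav gamma v *m phi)) =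
  dotr u (v *m crossmx w) *: phi +
    gammav gamma (v *m crossmx w *m crossmx u - dotr w v *: u) *m phi.
  rewrite gammav_mul_phi mulmxDr mulmxN -scalemxAr gammav_mul_phi.
  rewrite [gammav gamma (_ - _)]raddfB/= [gammav gamma (_ *: u)]linearZ/=.
  rewrite mulmxBl -[in RHS]scalemxAl.
  rewrite opprD opprK !scaleNr opprK addrC -addrA.
  by congr (_ + _).
have := congr1 (mulmx^~ (gammav gamma v *m phi)) (gammav_clifford x y).
rewrite mulmxDl -!mulmxA !H addrACA -mulmxDl -raddfD -scalerDl mul_scalar_mx.
have -> : (- 2 * dotr x y) *: (gammav gamma v *m phi) =
    0 *: phi + gammav gamma ((- 2 * dotr x y) *: v) *m phi.
  by rewrite scale0r add0r linearZ/= scalemxAl.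
move=> /gammav_phi_inj[_ <-].
rewrite !mulmxA (dotrC v y) (dotrC v x).
move: (_ *m crossmx x) (_ *m crossmx y) => p q.
by apply/rowP => k; rewrite !mxE; ring.
Qed.

(** Two instances of [crossmx_anticomm] suffice: for x, y applied to v, and for x, v applied to y.
    In the second, [cross_skew] brings v back to the last place, and x * (y * v) is expressed
    through (x * y) * v. *)
Lemma crossmx_comm x y : crossmx y *m crossmx x - crossmx x *m crossmx y =
  - 2 *: crossmx (y *m crossmx x) + 3 *: (x^T *m y - y^T *m x).
Proof.
apply/row_matrixP => i; rewrite !rowE; move: (delta_mx 0 i) => v.
have := congr1 (mulmx v) (crossmx_anticomm x y).
have := congr1 (mulmx y) (crossmx_anticomm x v).
rewrite !(mulmxDr, mulmxN, =^~ scalemxAr) mulmxA (cross_skew v y).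
rewrite (cross_skew (y *m crossmx x) v) mulNmx !mulmxA mul_mx_scalar.
rewrite !mul_mx_scalar !dotrM !mul_scalar_mx.
move: (_ *m crossmx x) (v *m _ *m crossmx y) (_ *m crossmx v) => p q r.
rewrite (dotrC x v) (dotrC v y) (dotrC x y) => E2 E1; apply/rowP => k.
move: (congr1 (fun a : 'rV_7 => a 0 k) E1) (congr1 (fun a : 'rV_7 => a 0 k) E2).
rewrite !mxE; lra.
Qed.

Lemma crossmx_tr x : (crossmx x)^T = - crossmx x.
Proof.
apply/matrixP => i k; rewrite !mxE -!gammav_delta.
rewrite [in LHS]spdot_gammav [in LHS]spdot_gammav opprK [LHS]spdotC.
by rewrite [in RHS]spdot_gammav opprK.
Qed.

(** Tracing [crossmx_anticomm] makes twice this trace equal to (-14 + 1 + 1) <x, y>. *)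
Lemma mxtrace_crossmx2 x y : \tr (crossmx y *m crossmx x) = - 6 * dotr x y.
Proof.
have := congr1 mxtrace (crossmx_anticomm x y).
rewrite !raddfD/= mxtrace_scalar !mxtrace_dotr (mxtrace_mulC (crossmx x)).
rewrite (dotrC y x) -mulr_natr; lra.
Qed.

Lemma mxtrace_mul_tr (m n : nat) (A B : 'M[R]_(m, n)) :
  \tr (A *m B^T) = \sum_i \sum_j A i j * B i j.
Proof.
by apply: eq_bigr => i _; rewrite mxE; apply: eq_bigr => j _; rewrite mxE.
Qed.

(* Hence every vector is a sum of cross products. *)
Lemma sum_cross_cross (v : 'rV[R]_7) :
  \sum_(i < 7) (v *m crossmx (delta_mx 0 i) *m crossmx (delta_mx 0 i)) =
    - 6 *: v.
Proof.
have E i : v *m crossmx (delta_mx 0 i) *m crossmx (delta_mx 0 i) =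
    - v + v 0 i *: delta_mx 0 i.
  have := congr1 (mulmx v) (crossmx_anticomm (delta_mx 0 i) (delta_mx 0 i)).
  rewrite !mulmxDr !mulmxA mul_mx_scalar !dotrM !mul_scalar_mx.
  rewrite dotr_delta eqxx mulr1 dotr_deltar.
  move: (_ *m crossmx _) => p E; apply/rowP => k.
  by move: (congr1 (fun a : 'rV_7 => a 0 k) E); rewrite !mxE; lra.
rewrite (eq_bigr _ (fun i _ => E i)) big_split/= -row_sum_delta sumr_const.
by rewrite card_ord -scaler_nat; apply/rowP => k; rewrite !mxE; ring.
Qed.

(** * Derivations of the cross product and the trace condition *)

Definition derivation (b : 'M[R]_7) : Prop := forall x y : 'rV[R]_7,
  y *m crossmx x *m b = y *m crossmx (x *m b) + y *m b *m crossmx x.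

Lemma derivationE b : derivation b ->
  forall x, crossmx x *m b - b *m crossmx x = crossmx (x *m b).
Proof.
move=> db x; apply/row_matrixP => i; rewrite !rowE mulmxDr mulmxN !mulmxA db.
by rewrite addrK.
Qed.

(** The form tr (L_x L_y) is invariant under b, by cyclicity of the trace, and is a nonzero multiple
    of the dot product. *)
Lemma derivation_skew b : derivation b -> b^T = - b.
Proof.
move=> /derivationE db.
have E x y : dotr (x *m b) y + dotr x (y *m b) = 0.
  have : \tr (crossmx y *m crossmx (x *m b)) +
         \tr (crossmx (y *m b) *m crossmx x) = 0.
    rewrite -!db mulmxBr mulmxBl !raddfB/= !mulmxA.
    have -> : \tr (b *m crossmx y *m crossmx x) =
        \tr (crossmx y *m crossmx x *m b).
      by rewrite -mulmxA mxtrace_mulC.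
    by rewrite subrKA subrr.
  rewrite !mxtrace_crossmx2; lra.
apply/matrixP => i j; rewrite !mxE -!dotr_deltaM.
have := E (delta_mx 0 i) (delta_mx 0 j).
rewrite (dotrC _ (_ *m b)); lra.
Qed.

Lemma derivation_mxtrace b v : derivation b -> \tr (b *m crossmx v) = 0.
Proof.
move=> db; have bT := derivation_skew db; move/derivationE in db.
have tr_b x y : \tr (b *m (x^T *m y)) = dotr (y *m b) x.
  by rewrite mulmxA mxtrace_mulC mulmxA mxtrace_mulC -/(dotr _ _) mxtrace_dotr.
(* Pair [crossmx_comm] with b. The commutator gives -6 <b x, y> by [mxtrace_crossmx2], and so does
   the rank-two term, as 3 times -2 <b x, y>; only the trace in question remains. *)
have tr_cross x y : \tr (b *m crossmx (y *m crossmx x)) = 0.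
  have := congr1 (fun a => \tr (b *m a)) (crossmx_comm x y).
  rewrite /= mulmxBr mulmxDr -!scalemxAr mulmxBr mxtraceD !mxtraceZ.
  rewrite ![\tr (_ - _)]raddfB/= !tr_b.
  rewrite mulmxA mxtrace_mulC mulmxA [in X in _ - X]mulmxA.
  rewrite -raddfB/= -mulmxBl db mxtrace_crossmx2 (dotrC y (x *m b)).
  have -> : dotr (y *m b) x = - dotr (x *m b) y.
    by rewrite dotr_mulmx bT mulmxN dotrC dotrNl.
  lra.
have := congr1 (fun a => \tr (b *m crossmx a)) (sum_cross_cross v).
rewrite /= linear_sum mulmx_sumr raddf_sum/= linearZ/= -scalemxAr mxtraceZ.
rewrite big1 => [|i _]; last exact: tr_cross.
by move=> /esym/eqP; rewrite mulf_eq0 oppr_eq0 pnatr_eq0/= => /eqP.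
Qed.

(** With b the connection matrix, this makes the zeroth-order term of the spin connection skew,
    hence orthogonal to phi when applied to phi. *)
Lemma quad_sum_skew (b : 'M[R]_7) : b^T = - b ->
  (\sum_i \sum_j b i j *: (gamma i *m gamma j))^T =
  - \sum_i \sum_j b i j *: (gamma i *m gamma j).
Proof.
move=> bT; rewrite raddf_sum/= exchange_big/= -sumrN; apply: eq_bigr => j _.
rewrite raddf_sum/= -sumrN; apply: eq_bigr => i _.
rewrite linearZ/= trmx_mul !(gamma_skew gamma_cl) mulmxN mulNmx opprK.
by rewrite -scaleNr; congr (_ *: _); move/matrixP: bT => /(_ i j); rewrite !mxE.
Qed.

(** Used twice: with b the matrix of S it computes D phi, and with b skew it tells when the spin
    action of b kills phi. *)
Lemma quad_sum_phi (b : 'M[R]_7) :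
  (\sum_i \sum_j b i j *: (gamma i *m gamma j)) *m phi =
  - \tr b *: phi +
    gammav gamma (\row_k \tr (b *m crossmx (delta_mx 0 k))) *m phi.
Proof.
have E i j : gamma i *m gamma j *m phi = - (i == j)%:R *: phi -
    gammav gamma (delta_mx 0 j *m crossmx (delta_mx 0 i)) *m phi.
  by rewrite -!gammav_delta -mulmxA gammav_mul_phi dotr_delta.
rewrite mulmx_suml.
transitivity (\sum_i \sum_j b i j *: (- (i == j)%:R *: phi -
    gammav gamma (delta_mx 0 j *m crossmx (delta_mx 0 i)) *m phi)).
  apply: eq_bigr => i _; rewrite mulmx_suml; apply: eq_bigr => j _.
  by rewrite -scalemxAl E.
transitivity (\sum_i \sum_j (b i j * - (i == j)%:R) *: phi +
    (\sum_i \sum_j gammav gamma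
      (- b i j *: (delta_mx 0 j *m crossmx (delta_mx 0 i)))) *m phi).
  rewrite mulmx_suml -big_split/=; apply: eq_bigr => i _.
  rewrite mulmx_suml -big_split/=; apply: eq_bigr => j _.
  by rewrite linearZ/= -scalemxAl scalerBr scalerA scaleNr.
congr (_ + _); last congr (_ *m phi).
  rewrite /mxtrace -sumrN scaler_suml; apply: eq_bigr => i _.
  rewrite (bigD1 i)//= eqxx mulrN1 big1 ?addr0// => j /negPf ji.
  by rewrite eq_sym ji oppr0 mulr0 scale0r.
transitivity (gammav gamma (\sum_i \sum_j
    (- b i j *: (delta_mx 0 j *m crossmx (delta_mx 0 i))))).
  by rewrite raddf_sum; apply: eq_bigr => i _; rewrite raddf_sum.
congr (gammav gamma _); apply/rowP => k; rewrite [RHS]mxE.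
rewrite -[crossmx _]opprK -crossmx_tr mulmxN raddfN/=.
rewrite mxtrace_mul_tr -sumrN summxE.
apply: eq_bigr => i _; rewrite summxE -sumrN; apply: eq_bigr => j _.
rewrite -rowE mxE [X in _ * X]mxE mulNr; congr (- (_ * _)).
(* Both sides are entries of the 3-form, with indices cyclically permuted; the cyclic shift is a
   composite of the transpositions [crossmx_tr] and [cross_skew]. *)
rewrite -[crossmx _ j k]opprK.
have -> : - crossmx (delta_mx 0 i) j k = crossmx (delta_mx 0 i) k j.
  have /matrixP/(_ k j) := crossmx_tr (delta_mx 0 i).
  by rewrite [X in X = _]mxE [X in _ = X]mxE => ->; rewrite opprK.
have /rowP/(_ j) := cross_skew (delta_mx 0 i) (delta_mx 0 k).
rewrite -!rowE ![row _ _ _ _]mxE [X in _ = X]mxE [row _ _ _ _]mxE => ->.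
by rewrite opprK.
Qed.

(** A quarter of the sum is the spin lift of b. Moving x past e_i e_j leaves 2 x_i e_j - 2 x_j e_i,
    and skewness of b makes the two halves equal. *)
Lemma quad_sum_comm (b : 'M[R]_7) x : b^T = - b ->
  (\sum_i \sum_j b i j *: (gamma i *m gamma j)) *m gammav gamma x -
  gammav gamma x *m (\sum_i \sum_j b i j *: (gamma i *m gamma j)) =
  4 *: gammav gamma (x *m b).
Proof.
move=> bT.
transitivity (\sum_i \sum_j
    (b i j *: (2 * x 0 i *: gamma j - 2 * x 0 j *: gamma i))).
  rewrite mulmx_suml mulmx_sumr -sumrB; apply: eq_bigr => i _.
  rewrite mulmx_suml mulmx_sumr -sumrB; apply: eq_bigr => j _.
  rewrite -scalemxAl -scalemxAr -scalerBr; congr (_ *: _).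
  have D k : dotr (delta_mx 0 k) x = x 0 k by rewrite dotrC dotr_deltar.
  have := gammav_clifford (delta_mx 0 j) x; rewrite gammav_delta D.
  have := gammav_clifford (delta_mx 0 i) x; rewrite gammav_delta D.
  move=> /(canRL (addrK _)) Ei /(canRL (addrK _)) Ej.
  rewrite -mulmxA Ej mulmxBr mul_mx_scalar mulmxA Ei mulmxBl mul_scalar_mx.
  by rewrite mulmxA opprB addrCA addrAC subrr add0r !mulNr !scaleNr opprK addrC.
under eq_bigr do under eq_bigr do rewrite scalerBr !scalerA.
under eq_bigr do rewrite sumrB.
rewrite sumrB exchange_big/= -sumrB /gammav scaler_sumr; apply: eq_bigr => i _.
rewrite mxE scalerA mulr_sumr scaler_suml -sumrB; apply: eq_bigr => j _.
rewrite -scalerBl; congr (_ *: _).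
have /matrixP/(_ i j) := bT; rewrite !mxE => ->; ring.
Qed.

(** The trace condition puts the spin lift of b in the stabiliser of phi in spin(7), which is g2:
    the cross product is determined by Clifford multiplication and phi, so what fixes both derives
    it. *)
Lemma skew_derivation b : b^T = - b ->
  (forall v, \tr (b *m crossmx v) = 0) -> derivation b.
Proof.
move=> bT trb.
pose B := \sum_i \sum_j b i j *: (gamma i *m gamma j).
have Bphi : B *m phi = 0.
  rewrite quad_sum_phi [X in gammav _ X](_ : _ = 0).
    rewrite linear0 mul0mx addr0.
    have /eqP := mxtrace_tr b.
    rewrite bT raddfN/= -subr_eq0 -opprD oppr_eq0 -mulr2n mulrn_eq0 => /eqP ->.
    by rewrite oppr0 scale0r.
  by apply/rowP => k; rewrite !mxE trb.
have Bg x psi : B *m (gammav gamma x *m psi) =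
    4 *: (gammav gamma (x *m b) *m psi) + gammav gamma x *m (B *m psi).
  by rewrite scalemxAl -(quad_sum_comm _ bT) mulmxBl !mulmxA subrK.
move=> x y.
have := congr1 (mulmx B) (gammav_mul_phi x y).
rewrite Bg mulmxBr Bg Bphi mulmx0 addr0 -!scalemxAr Bg Bphi.
rewrite !mulmx0 scaler0 addr0.
rewrite sub0r -scalerDr -scalerN => /(scalerI (_ : 4 != 0)).
rewrite pnatr_eq0 => /(_ isT).
(* The coefficients of phi cancel since <b x, y> + <x, b y> = 0; the vector parts give the
   derivation rule. *)
rewrite !gammav_mul_phi addrACA -scalerDl dotr_mulmx bT mulmxN.
rewrite dotrC dotrNl opprK (dotrC x) subrr scale0r add0r.
rewrite -opprD => /oppr_inj; rewrite -mulmxDl -raddfD => /gammav_phi_inj1 <-.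
by [].
Qed.

(** Split s into skew and symmetric parts: tr s sees only the symmetric part and, L_v being skew, tr
    (s L_v) only the skew part. *)
Lemma trace_conditionP (s : 'M[R]_7) :
  (\tr s = 0 /\ forall v, \tr (s *m crossmx v) = 0) <->
  exists b2 b3, [/\ derivation b2, b3^T = b3, \tr b3 = 0 & s = b2 + b3].
Proof.
have sym_tr b v : b^T = b -> \tr (b *m crossmx v) = 0.
  move=> bT; have /eqP := mxtrace_tr (b *m crossmx v).
  rewrite trmx_mul crossmx_tr bT mulNmx raddfN/= mxtrace_mulC.
  by rewrite -subr_eq0 -opprD oppr_eq0 -mulr2n mulrn_eq0 => /eqP.
have skew_tr (b : 'M[R]_7) : b^T = - b -> \tr b = 0.
  move=> bT; have /eqP := mxtrace_tr b; rewrite bT raddfN/=.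
  by rewrite -subr_eq0 -opprD oppr_eq0 -mulr2n mulrn_eq0 => /eqP.
split=> [[trs crs]|[b2 [b3 [d2 s3 t3 ->]]]]; last first.
  split; first by rewrite mxtraceD t3 addr0 skew_tr//; exact: derivation_skew.
  by move=> v; rewrite mulmxDl mxtraceD derivation_mxtrace// sym_tr// addr0.
have skew2 : (2^-1 *: (s - s^T))^T = - (2^-1 *: (s - s^T)).
  by rewrite linearZ/= raddfB/= trmxK -scalerN opprB.
have sym3 : (2^-1 *: (s + s^T))^T = 2^-1 *: (s + s^T).
  by rewrite linearZ/= raddfD/= trmxK addrC.
have dec : s = 2^-1 *: (s - s^T) + 2^-1 *: (s + s^T).
  by apply/matrixP => i j; rewrite !mxE; lra.
exists (2^-1 *: (s - s^T)), (2^-1 *: (s + s^T)); split=> //; last first.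
  by rewrite mxtraceZ mxtraceD mxtrace_tr trs addr0 mulr0.
apply: skew_derivation => // v.
by have := crs v; rewrite {1}dec mulmxDl mxtraceD (sym_tr _ _ sym3) addr0.
Qed.

End SpinorAlgebra.

(** * Linearity of the derivative in the direction, which [Cn] does not assert *)

Section DirectionalDerivatives.
Variables (R : realType) (V : normedModType R).

Lemma is_derive_line (f : V -> R) y u t : derivable f (t *: u + y) u ->
  is_derive t 1 (fun s : R => f (s *: u + y)) ('D_u f (t *: u + y)).
Proof.
have E : (fun h : R => h^-1 *:
    (((fun s : R => f (s *: u + y)) \o shift t) (h *: 1) - f (t *: u + y))) =
    (fun h => h^-1 *: ((f \o shift (t *: u + y)) (h *: u) - f (t *: u + y))).
  by apply/funext => h /=; rewrite [h *: 1]mulr1 scalerDl addrA.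
by move=> df; split; rewrite /derivable /derive E.
Qed.

(** The segment is parametrised by [0, 1] so that k may have either sign. *)
Lemma MVT_line (f : V -> R) y u (k : R) :
  (forall t : R, 0 <= t <= 1 -> derivable f ((t * k) *: u + y) u) ->
  exists2 t : R, 0 <= t <= 1 &
    f (k *: u + y) - f y = k * 'D_u f ((t * k) *: u + y).
Proof.
move=> du.
have dg (t : R) : t \in `[0, 1]%R ->
    is_derive t 1 (fun s : R => f ((s * k) *: u + y))
      (k * 'D_u f ((t * k) *: u + y)).
  rewrite in_itv/= => /du/is_derive_line dt.
  have dk : is_derive t 1 (fun s : R => s * k) k.
    by apply: is_derive_eq; rewrite scaler0 add0r [_ *: _]mulr1.
  rewrite mulrC.
  exact: (@is_derive1_comp _ (fun s => f (s *: u + y)) (fun s => s * k)).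
have dg' t t01 := dg t (subset_itvW _ _ (lexx _) (lexx _) t01).
have [|t t01 E] := @MVT_segment R _ _ 0 1 ler01 dg'.
  by apply: derivable_within_continuous => t /dg[].
exists t; first by rewrite in_itv in t01.
by rewrite mul1r mul0r scale0r add0r subr0 mulr1 in E.
Qed.

(** Go from x to x + h (c u + v) along h c u and then h v, apply the mean value theorem on each leg,
    and use continuity of both derivatives at x. *)
Lemma derive_linear (f : V -> R) x u v c :
  (\forall y \near x, derivable f y u) ->
  (\forall y \near x, derivable f y v) ->
  {for x, continuous ('D_u f)} -> {for x, continuous ('D_v f)} ->
  'D_(c *: u + v) f x = c * 'D_u f x + 'D_v f x.
Proof.
move=> du dv cu cv; apply/cvg_lim => //; apply/cvgrPdist_le => e e0.
have c1 : 0 < `|c| + 1 by rewrite ltr_wpDl.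
have e'0 : 0 < e / (`|c| + 1) by rewrite divr_gt0.
move/cvgrPdist_le: cu => /(_ _ e'0) cu; move/cvgrPdist_le: cv => /(_ _ e'0) cv.
have /nbhs_ballP[d /= d0 xd] : \forall y \near x,
    (derivable f y u /\ derivable f y v) /\
    (`|'D_u f x - 'D_u f y| <= e / (`|c| + 1) /\
     `|'D_v f x - 'D_v f y| <= e / (`|c| + 1)).
  exact: filterI (filterI du dv) (filterI cu cv).
(* Both legs stay within |h| N of x; the summand 1 makes N positive. *)
pose N := `|c| * `|u| + `|v| + 1.
have N0 : 0 < N by rewrite ltr_wpDl// addr_ge0// mulr_ge0.
have inball (h t1 t2 : R) : `|h| < d / N -> 0 <= t1 <= 1 -> 0 <= t2 <= 1 ->
    ball x d ((t2 * h) *: v + ((t1 * (h * c)) *: u + x)).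
  move=> hd /andP[t10 t11] /andP[t20 t21].
  rewrite -ball_normE/= addrA opprD addrCA subrr addr0 normrN.
  apply: le_lt_trans (ler_normD _ _) _; rewrite !normrZ ?normrM.
  rewrite (ger0_norm t10) (ger0_norm t20).
  apply: (@le_lt_trans _ _ (`|h| * N)); last by rewrite -ltr_pdivlMr.
  have A1 : t2 * `|h| * `|v| <= `|h| * `|v|.
    by rewrite -mulrA ler_piMl// mulr_ge0.
  have A2 : t1 * (`|h| * `|c|) * `|u| <= `|h| * (`|c| * `|u|).
    by rewrite -!mulrA ler_piMl// !mulr_ge0.
  apply: le_trans (lerD A1 A2) _; rewrite -mulrDr ler_wpM2l// /N.
  by rewrite addrC lerDl.
near=> h.
have h0 : h != 0 by near: h; exact: nbhs_dnbhs_neq.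
have hd : `|h| < d / N by near: h; apply: dnbhs0_lt; rewrite divr_gt0.
have z01 : 0 <= (0 : R) <= 1 by rewrite lexx ler01.
have o01 : 0 <= (1 : R) <= 1 by rewrite lexx ler01.
have [|t1 t101 E1] := @MVT_line f x u (h * c).
  move=> t t01; have := inball h t 0 hd t01 z01.
  by rewrite mul0r scale0r add0r => ht; have [[dfu _] _] := xd _ ht.
have [|t2 t201 E2] := @MVT_line f ((h * c) *: u + x) v h.
  move=> t t01; have := inball h 1 t hd o01 t01.
  by rewrite mul1r => ht; have [[_ dfv] _] := xd _ ht.
have [_ [D1 _]] := xd _ (inball h t1 0 hd t101 z01).
have [_ [_ D2]] := xd _ (inball h 1 t2 hd o01 t201).
rewrite mul0r scale0r add0r in D1; rewrite mul1r in D2.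
have -> : (fun h => h^-1 *: ((f \o shift x) (h *: (c *: u + v)) - f x)) h =
    'D_v f ((t2 * h) *: v + ((h * c) *: u + x)) +
    c * 'D_u f ((t1 * (h * c)) *: u + x).
  rewrite /= (_ : h *: _ + x = h *: v + ((h * c) *: u + x)); last first.
    by rewrite scalerDr scalerA addrAC addrC.
  rewrite -(subrKA (f ((h * c) *: u + x))) E1 E2 -[LHS]/(h^-1 * _).
  by rewrite mulrDr mulKf// -mulrA mulKf.
rewrite (addrC (c * _)) opprD addrACA -mulrBr.
apply: (@le_trans _ _ (e / (`|c| + 1) + `|c| * (e / (`|c| + 1)))).
  apply: le_trans (ler_normD _ _) _.
  by rewrite normrM lerD// ler_wpM2l.
by rewrite -[X in X + _]mul1r -mulrDl addrC mulrC divfK// gt_eqF.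
Unshelve. all: by end_near. Qed.

End DirectionalDerivatives.

Section MatrixValued.
Variables (R : realType) (V : normedModType R).

Lemma derive_mx_linear m n (f : V -> 'M[R]_(m, n)) x u v c :
  (forall w, \forall y \near x, derivable f y w) ->
  (forall w, {for x, continuous ('D_w f)}) ->
  'D_(c *: u + v) f x = c *: 'D_u f x + 'D_v f x.
Proof.
move=> df cf.
have dfx w : derivable f x w by exact: nbhs_singleton (df w).
have dij w i j : \forall y \near x, derivable (fun z => f z i j) y w.
  by apply: filterS (df w) => y /derivable_mxP.
have cij w i j : {for x, continuous ('D_w (fun z => f z i j))}.
  have : (fun y => 'D_w f y i j) @ x --> 'D_w (fun z => f z i j) x.
    have -> : 'D_w (fun z => f z i j) x = 'D_w f x i j.
      by rewrite derive_mx// mxE.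
    exact: (cvg_comp _ _ (cf w) (@coord_continuous _ _ _ i j _)).
  apply: cvg_trans; apply: near_eq_cvg.
  by apply: filterS (df w) => y dfy; rewrite derive_mx// mxE.
rewrite !derive_mx//; first apply/matrixP => i j; rewrite ?mxE.
  exact: derive_linear.
Qed.

Lemma derive_unit n (f : V -> 'cV[R]_n) x v : derivable f x v ->
  (\forall y \near x, ((f y)^T *m f y) 0 0 = 1) ->
  (('D_v f x)^T *m f x) 0 0 = 0.
Proof.
move=> dfx f1.
have dk k : derivable (fun y => f y k 0) x v.
  by have /derivable_mxP := dfx; exact.
have : 'D_v (\sum_(k < n) (fun y => f y k 0) ^+ 2) x = 0.
  rewrite -(derive_cst (1 : R) x v); apply: near_eq_derive.
  apply: filterS f1 => y; rewrite mxE /= fct_sumE => <-.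
  by apply: eq_bigr => k _; rewrite !mxE.
rewrite derive_sum; last by move=> k; exact: derivableX.
move=> E; rewrite mxE; apply: (@mulfI _ 2); first by rewrite pnatr_eq0.
rewrite mulr0 -[RHS]E mulr_sumr.
apply: eq_bigr => k _; rewrite deriveX// derive_mx// !mxE /= expr1.
by rewrite -[RHS]/(_ * _) mulrAC mulrA.
Qed.
End MatrixValued.

(** * Orthogonality of the spin representation *)

Section SpinGroup.
Variables (R : realType) (gamma : 'I_7 -> 'M[R]_8).
Hypothesis gamma_cl : clifford_module gamma.

(** A unit vector acts by a skew matrix of square -1, hence orthogonally. *)
Lemma spin_group_orthogonal s : spin_group gamma s -> s^T *m s = 1%:M.
Proof.
move=> [vs [_ v1 ->]]; elim: vs v1 => [|v vs IH] v1.
  by rewrite big_nil trmx1 mulmx1.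
rewrite big_cons trmx_mul -mulmxA (mulmxA (gammav gamma v)^T).
have -> : (gammav gamma v)^T *m gammav gamma v = 1%:M.
  have := gammav_clifford gamma_cl v v.
  have := v1 v (mem_head _ _); rewrite dotrM => /(congr1 mxtrace).
  rewrite !mxtrace1 mxtrace_scalar mulr1n => ->.
  rewrite (gammav_tr gamma_cl) mulNmx => E.
  apply/matrixP => i j; move/matrixP: E => /(_ i j); rewrite !mxE; lra.
by rewrite mul1mx IH// => w wvs; apply: v1; rewrite in_cons wvs orbT.
Qed.

End SpinGroup.

(** * Charts and spinor trivializations *)

Section Geometry.
Variables (R : realType) (gamma : 'I_7 -> 'M[R]_8).
Hypothesis gamma_cl : clifford_module gamma.
Variables (M : topologicalType) (A : oriented_atlas R M).
Variables (g : riemannian_metric A) (P : spin_structure g gamma).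

Lemma near_chart_image (U : set M) p : open U -> U p ->
  \forall x \near cmap (chart_at A p) p,
    (cmap (chart_at A p) @` (U `&` cdom (chart_at A p))) x.
Proof.
move=> oU Up; set a := chart_at A p.
have ap : cdom a p := mem_chart_at A p.
have imp : (cmap a @` cdom a) (cmap a p) by exists p.
have n1 : \forall x \near cmap a p, (cmap a @` cdom a) x.
  by apply: open_nbhs_nbhs; split=> //; exact: cimg_open.
have n2 : \forall x \near cmap a p, U (cinv a x).
  apply: (cinv_continuous imp); rewrite cmapK//.
  by apply: open_nbhs_nbhs; split.
near=> x.
have [q aq qx] : (cmap a @` cdom a) x by near: x.
exists q => //; split=> //; rewrite -(cmapK aq) qx.
by near: x.
Unshelve. all: by end_near. Qed.

Lemma tdiff_near_cst (W : normedModType R) (U : set M) (f : M -> W) p v k :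
  open U -> U p -> (forall q, U q -> f q = k) -> tdiff A f p v = 0.
Proof.
move=> oU Up fk; rewrite -(derive_cst k (cmap (chart_at A p) p) v).
apply: near_eq_derive.
apply: filterS (near_chart_image oU Up) => x [q [Uq aq] <-].
by rewrite /= cmapK// fk.
Qed.

Lemma smooth_on_Cn1 m n (U : set M) (f : M -> 'M[R]_(m, n)) p :
    open U -> U p -> smooth_on A U f ->
  let F := f \o cinv (chart_at A p) in let x := cmap (chart_at A p) p in
  (forall w, \forall y \near x, derivable F y w) /\
  (forall w, {for x, continuous ('D_w F)}).
Proof.
move=> oU Up /(_ (chart_at A p) 1) [_ Cf] F x; split=> w; have [df cf] := Cf w.
  by apply: filterS (near_chart_image oU Up) => y /df.
have [cf' _] := cf; apply: cf'.
exact: nbhs_singleton (near_chart_image oU Up).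
Qed.

Lemma tdiff_linear m n (U : set M) (f : M -> 'M[R]_(m, n)) p c u v :
    open U -> U p -> smooth_on A U f ->
  tdiff A f p (c *: u + v) = c *: tdiff A f p u + tdiff A f p v.
Proof.
move=> oU Up sf; have [] := smooth_on_Cn1 oU Up sf.
exact: derive_mx_linear.
Qed.

Lemma spin_trans_orthogonal (a b : spin_ix P) q :
  spin_dom a q -> spin_dom b q ->
  (spin_trans a b q)^T *m spin_trans a b q = 1%:M.
Proof.
move=> aq bq; apply: (spin_group_orthogonal gamma_cl).
exact: spin_trans_spin.
Qed.

(** The cocycle condition makes it idempotent, and it is invertible. *)
Lemma spin_trans_id (a : spin_ix P) q : spin_dom a q -> spin_trans a a q = 1%:M.
Proof.
move=> aq; have /mulmx1_unit[_ u] := spin_trans_orthogonal aq aq.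
by rewrite -[LHS]mulmx1 -(mulmxV u) mulmxA spin_cocycle.
Qed.

(** * Frame coordinates at a point *)

Variable p : M.
(** [x *m F] is the tangent vector with frame coordinates x. *)
Let F : 'M[R]_7 := \matrix_i frame_at P p i.
Let dom_p : spin_dom (spin_at P p) p := mem_spin_at P p.
Let dom_open : open (spin_dom (spin_at P p)) := spin_dom_open (spin_at P p).

Lemma frame_unit : F \in unitmx.
Proof.
rewrite unitmxE unitfE gt_eqF//.
exact: spin_frame_oriented (mem_spin_at P p).
Qed.

Lemma metricDl u v w : g p (u + v) w = g p u w + g p v w.
Proof. by rewrite -[u]scale1r metric_linear mul1r scale1r. Qed.

Lemma metric0l w : g p 0 w = 0.
Proof. by apply: (@addrI _ (g p 0 w)); rewrite -metricDl !addr0. Qed.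

Lemma metricZl c u w : g p (c *: u) w = c * g p u w.
Proof. by rewrite -[c *: u]addr0 metric_linear metric0l addr0. Qed.

Lemma metric_suml I (r : seq I) (G : I -> 'rV[R]_7) w :
  g p (\sum_(i <- r) G i) w = \sum_(i <- r) g p (G i) w.
Proof.
exact: (big_morph (fun u => metric g p u w) (fun u v => metricDl u v w)
  (metric0l w)).
Qed.

Lemma mul_frame (x : 'rV[R]_7) : x *m F = \sum_i x 0 i *: frame_at P p i.
Proof. by rewrite mulmx_sum_row; apply: eq_bigr => i _; rewrite rowK. Qed.

Lemma metric_frame x i : g p (x *m F) (frame_at P p i) = x 0 i.
Proof.
rewrite mul_frame metric_suml (bigD1 i)//= metricZl.
rewrite (spin_frame_orthonormal _ _ dom_p) eqxx mulr1 big1 ?addr0// => j ji.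
by rewrite metricZl (spin_frame_orthonormal _ _ dom_p) (negPf ji) mulr0.
Qed.

Lemma metric_dotr x y : g p (x *m F) (y *m F) = dotr x y.
Proof.
rewrite metricC mul_frame metric_suml dotrE; apply: eq_bigr => i _.
by rewrite metricZl metricC metric_frame mulrC.
Qed.

Lemma clifford_frame x psi :
  clifford P p (x *m F) psi = gammav gamma x *m psi.
Proof.
by congr (_ *m _); apply: eq_bigr => i _; rewrite metric_frame.
Qed.

Lemma frame_atE i : frame_at P p i = delta_mx 0 i *m F.
Proof. by rewrite -rowE rowK. Qed.

Variable phi : M -> 'cV[R]_8.
Hypothesis phi1 : unit_spinor phi.
Local Notation L := (crossmx gamma (phi p)).

Lemma cross_frame x y :
  cross P phi p (x *m F) (y *m F) = y *m L x *m F.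
Proof.
rewrite /cross [RHS]mul_frame; apply: eq_bigr => i _; congr (_ *: _).
rewrite /Psi [in LHS]frame_atE !clifford_frame -(crossmx_spdot _ _ y).
rewrite dotr_mulmx (crossmx_tr gamma_cl) mulmxN -(cross_skew gamma_cl (phi1 p)).
by rewrite dotrC dotr_deltar.
Qed.

Section Conjugation.
Variables B b : 'M[R]_7.
(** B and b are one endomorphism, in chart and in frame coordinates. *)
Hypothesis FB : F *m B = b *m F.

Lemma W2P : W2 P phi p B <-> derivation gamma (phi p) b.
Proof.
have xFB (x : 'rV[R]_7) : x *m F *m B = x *m b *m F by rewrite -!mulmxA FB.
have FK := mulmxK frame_unit; have FVK := mulmxKV frame_unit.
split=> [w x y|d X Y].
  apply: (can_inj (FK _)); have := w (x *m F) (y *m F).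
  by rewrite !xFB !cross_frame xFB mulmxDl.
rewrite -(FVK _ X) -(FVK _ Y) !xFB !cross_frame xFB -mulmxDl.
by rewrite -d.
Qed.

Lemma W3P : W3 g p B <-> b^T = b /\ \tr b = 0.
Proof.
have xFB (x : 'rV[R]_7) : x *m F *m B = x *m b *m F by rewrite -!mulmxA FB.
have FVK := mulmxKV frame_unit.
have <- : \tr B = \tr b.
  rewrite -[b](mulmxK frame_unit) -FB mxtrace_mulC mulmxA mulVmx.
    by rewrite mul1mx.
  exact: frame_unit.
split=> -[H trB]; split=> //.
  apply/matrixP => i j.
  have := H (delta_mx 0 j *m F) (delta_mx 0 i *m F).
  by rewrite !xFB !metric_dotr [in RHS]dotrC !dotr_deltaM mxE.
move=> X Y; rewrite -(FVK _ X) -(FVK _ Y) !xFB !metric_dotr.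
by rewrite dotr_mulmx H.
Qed.

End Conjugation.

Lemma W23P B b : F *m B = b *m F -> W23 P phi p B <->
  exists b2 b3, [/\ derivation gamma (phi p) b2, b3^T = b3, \tr b3 = 0
    & b = b2 + b3].
Proof.
move=> FB; split=> [[B2 [B3 [w2 w3 BE]]]|[b2 [b3 [d2 s3 t3 bE]]]].
  pose cj C := F *m C *m invmx F.
  have cjP C : F *m C = cj C *m F by rewrite mulmxKV// frame_unit.
  have [s3 t3] := (W3P (cjP B3)).1 w3.
  exists (cj B2), (cj B3); split=> //; first exact: (W2P (cjP B2)).1.
  by rewrite -[LHS](mulmxK frame_unit) -FB BE mulmxDr mulmxDl.
pose cj c := invmx F *m c *m F.
have cjP c : F *m cj c = c *m F by rewrite !mulmxA mulmxV ?mul1mx ?frame_unit.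
exists (cj b2), (cj b3); split; [exact/(W2P (cjP b2))| exact/(W3P (cjP b3)) |].
by rewrite -[LHS](mulKmx frame_unit) FB bE mulmxDl mulmxDr !mulmxA.
Qed.

(** * The spin connection, the matrix of S and the Dirac operator *)

Variable nabla : M -> 'rV[R]_7 -> (M -> 'rV[R]_7) -> 'rV[R]_7.
Hypothesis nabla_lc : levi_civita g nabla.
Hypothesis phi_smooth : smooth_spinor P phi.

Let conn X : 'M[R]_7 :=
  \matrix_(i, j) g p (nabla p X (spin_frame (spin_at P p) i)) (frame_at P p j).

Lemma frame_smooth_near i : smooth_field_near A p (spin_frame (spin_at P p) i).
Proof.
exists (spin_dom (spin_at P p)); last exact: spin_frame_smooth.
by split=> //; exact: dom_open.
Qed.

Lemma conn_skew X : (conn X)^T = - conn X.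
Proof.
apply/matrixP => i j; rewrite !mxE.
have := lc_metric nabla_lc X (frame_smooth_near i) (frame_smooth_near j).
rewrite (@tdiff_near_cst _ (spin_dom (spin_at P p)) _ _ _
  ((i == j)%:R : R^o)) //.
- rewrite [g p (spin_frame _ i p) _]metricC => /esym/eqP.
  by rewrite addrC addr_eq0 => /eqP.
- by move=> q; exact: spin_frame_orthonormal.
Qed.

Lemma conn_linear c u v : conn (c *: u + v) = c *: conn u + conn v.
Proof.
apply/matrixP => i j; rewrite !mxE (nabla_linear (lc_connection nabla_lc)).
  exact: metric_linear.
exact: frame_smooth_near.
Qed.

Lemma spin_nablaE X : spin_nabla P nabla p X phi =
  tdiff A (spinor_in (spin_at P p) phi) p X +
  4^-1 *: ((\sum_i \sum_j conn X i j *: (gamma i *m gamma j)) *m phi p).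
Proof.
congr (_ + _ *: _); rewrite mulmx_suml; apply: eq_bigr => i _.
by rewrite mulmx_suml; apply: eq_bigr => j _; rewrite mxE scalemxAl.
Qed.

Lemma spin_nabla_linear c u v : spin_nabla P nabla p (c *: u + v) phi =
  c *: spin_nabla P nabla p u phi + spin_nabla P nabla p v phi.
Proof.
rewrite !spin_nablaE (tdiff_linear _ _ _ dom_open dom_p (phi_smooth _)).
rewrite conn_linear scalerDr addrACA; congr (_ + _).
rewrite scalerA mulrC -scalerA -scalerDr; congr (_ *: _).
rewrite scalemxAl -mulmxDl; congr (_ *m _).
rewrite scaler_sumr -big_split/=; apply: eq_bigr => i _.
rewrite scaler_sumr -big_split/=; apply: eq_bigr => j _.
by rewrite !mxE scalerDl scalerA.
Qed.

(** The connection term is skew. The derivative term is taken in the fixed trivialization at p,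
    where phi still has norm 1 nearby because the transition matrices are orthogonal. *)
Lemma spdot_spin_nabla X : spdot (spin_nabla P nabla p X phi) (phi p) = 0.
Proof.
rewrite spin_nablaE spdotDl spdotZl.
rewrite (spdot_skew _ (quad_sum_skew gamma_cl (conn_skew X))).
rewrite mulr0 addr0.
have sE : spinor_in (spin_at P p) phi p = phi p.
  by rewrite /spinor_in (spin_trans_id dom_p) mul1mx.
have [df _] := smooth_on_Cn1 dom_open dom_p (phi_smooth (spin_at P p)).
have := @derive_unit _ _ _ _ _ X (nbhs_singleton (df X)).
rewrite /= cmapK ?sE; last exact: mem_chart_at.
apply; apply: filterS (near_chart_image dom_open dom_p).
move=> x [q [eq aq] <-]; rewrite /= cmapK// /spinor_in trmx_mul mulmxA.
rewrite -(mulmxA (phi q)^T) spin_trans_orthogonal//.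
  by rewrite mulmx1; exact: phi1.
exact: mem_spin_at.
Qed.

(** Row i will be S(e_i) in frame coordinates. *)
Let s : 'M[R]_7 :=
  \matrix_i spinor_vec gamma (phi p)
    (spin_nabla P nabla p (frame_at P p i) phi).

Lemma spin_nabla_frame x : spin_nabla P nabla p (x *m F) phi =
  gammav gamma (x *m s) *m phi p.
Proof.
have lin : linear (fun X => spin_nabla P nabla p X phi).
  exact: spin_nabla_linear.
pose N : {linear 'rV[R]_7 -> 'cV[R]_8} := HB.pack
  (fun X => spin_nabla P nabla p X phi) (GRing.isLinear.Build _ _ _ _ _ lin).
rewrite -[LHS]/(N _) mul_frame linear_sum mulmx_sum_row raddf_sum mulmx_suml.
apply: eq_bigr => i _; rewrite linearZ/= rowK linearZ/= -scalemxAl.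
congr (_ *: _).
rewrite [LHS](spinor_dec gamma_cl (phi1 p)).
by rewrite spdot_spin_nabla scale0r add0r.
Qed.

Lemma dirac_opE : dirac_op P nabla phi p =
  (\sum_i \sum_j s i j *: (gamma i *m gamma j)) *m phi p.
Proof.
rewrite mulmx_suml; apply: eq_bigr => i _.
rewrite frame_atE clifford_frame spin_nabla_frame gammav_delta -rowE.
rewrite (gammav_mulE gamma (row i s)) mulmx_sumr mulmx_suml.
by apply: eq_bigr => j _; rewrite -scalemxAr -scalemxAl mulmxA mxE.
Qed.

Lemma dirac_op_eq0 : dirac_op P nabla phi p = 0 <->
  \tr s = 0 /\ forall v, \tr (s *m L v) = 0.
Proof.
rewrite dirac_opE (quad_sum_phi gamma_cl (phi1 p)); split.
  rewrite -[X in _ = X -> _]addr0 -{1}(scale0r (phi p)) -(mul0mx _ (phi p)).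
  rewrite -(linear0 (gammav gamma)).
  move=> /(gammav_phi_inj gamma_cl (phi1 p))[/eqP].
  rewrite oppr_eq0 => /eqP -> /rowP s0; split=> // v.
  rewrite (row_sum_delta v) linear_sum mulmx_sumr raddf_sum big1 // => k _.
  rewrite linearZ/= -scalemxAr mxtraceZ.
  by have := s0 k; rewrite !mxE => ->; rewrite mulr0.
move=> [-> s0]; rewrite oppr0 scale0r add0r.
rewrite (_ : \row_k _ = 0) ?linear0 ?mul0mx//.
by apply/rowP => k; rewrite !mxE s0.
Qed.

(** Existence and uniqueness of S at p: x is determined by x phi, so S must be [s] conjugated by the
    frame. *)
Lemma intrinsic_frame S :
  (forall X, spin_nabla P nabla p X phi = clifford P p (X *m S) (phi p)) <->
  F *m S = s *m F.
Proof.
have FVK := mulmxKV frame_unit; have FK := mulmxK frame_unit.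
split=> [H|FS X].
  apply/row_matrixP => i; rewrite !rowE !mulmxA.
  have := H (delta_mx 0 i *m F); rewrite spin_nabla_frame.
  rewrite -(FVK _ (delta_mx 0 i *m F *m S)) clifford_frame.
  by move=> /(gammav_phi_inj1 gamma_cl (phi1 p)) <-.
by rewrite -(FVK _ X) spin_nabla_frame -(mulmxA _ F S) FS mulmxA clifford_frame.
Qed.

Lemma harmonic_at_P : dirac_op P nabla phi p = 0 <->
  exists2 S, forall X, spin_nabla P nabla p X phi =
      clifford P p (X *m S) (phi p)
    & W23 P phi p S.
Proof.
rewrite dirac_op_eq0 (trace_conditionP gamma_cl (phi1 p)); split.
  move=> H; exists (invmx F *m s *m F).
    by apply/intrinsic_frame; rewrite !mulmxA mulmxV ?mul1mx ?frame_unit.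
  by apply/(@W23P _ s) => //; rewrite !mulmxA mulmxV ?mul1mx ?frame_unit.
by move=> [S /intrinsic_frame FS /(W23P FS)].
Qed.

End Geometry.

Theorem theorem4p6 (R : realType) (gamma : 'I_7 -> 'M[R]_8)
    (gamma_cl : clifford_module gamma)
    (M : topologicalType) (A : oriented_atlas R M) (g : riemannian_metric A)
    (P : spin_structure g gamma)
    (nabla : M -> 'rV[R]_7 -> (M -> 'rV[R]_7) -> 'rV[R]_7)
    (nabla_lc : levi_civita g nabla)
    (phi : M -> 'cV[R]_8)
    (phi_smooth : smooth_spinor P phi) (phi_unit : unit_spinor phi) :
  harmonic_spinor P nabla phi <-> class_W23 P nabla phi.
Proof.
have pointwise p := harmonic_at_P gamma_cl p phi_unit nabla_lc phi_smooth.
split=> [H|[S iS wS] p]; last by apply/pointwise; exists (S p).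
have {}H p : exists S, (forall X, spin_nabla P nabla p X phi =
    clifford P p (X *m S) (phi p)) /\ W23 P phi p S.
  by have [S ? ?] := (pointwise p).1 (H p); exists S.
(* [class_W23] asks for a single field S, assembled here from its values at the points. *)
by have [S HS] := choice H; exists S => p; have [] := HS p.
Qed.
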